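(* Let $n\ge 1$, let $A,b,c,d>0$ and $K_{ex}\ge 0$, and let $\alpha_1^2,\dots,\alpha_n^2\in[0,\infty)$. Then there exists a unique equilibrium $(r_j,q_j)_{1\le j\le n}$ (with the convention that $r_j=0$ whenever $q_j=0$).
   Context: There are $n$ firms. Firm $i$ chooses a technology $r_i\in[0,1]$ and a production quantity $q_i\in[0,\infty)$; its carbon emission is $k_i=r_iq_i$. The convention $r_i=0$ is imposed whenever $q_i=0$. $K_{ex}\ge0$ is an exogenous amount of carbon. The number $\alpha_i^2=E_i[\alpha^2]\ge 0$ (a symbol for a nonnegative real) is the second moment of a random variable $\alpha$ under firm $i$'s subjective belief. Put $Q=\sum_{j=1}^n q_j$, $K=K_{ex}+\sum_{j=1}^n r_jq_j$, $Q_{-i}=Q-q_i$, $K_{-i}=K-k_i$. Consumers have utility $u(x)=-\tfrac12(A-x)^2$ for $x\in[0,A]$ and $u(x)=0$ for $x>A$, so the inverse demand is $u'(x)=(A-x)^+$. Given $Q_{-i},K_{-i}$, the expected profit of firm $i$ for the choice $(r,q)\in[0,1]\times[0,\infty)$ is $$E_i[\pi_i(r,q)]=(A-q-Q_{-i})^+\,q-b\alpha_i^2\,(rq+K_{-i})\,rq-(c+d-dr)\,q .$$ An equilibrium (Nash) is a profile $(r_j,q_j)_{1\le j\le n}$ such that, for every $1\le i\le n$, $(r_i,q_i)$ maximizes $E_i[\pi_i(\cdot,\cdot)]$ over $[0,1]\times[0,\infty)$ given $Q_{-i}=\sum_{j\ne i}q_j$ and $K_{-i}=K_{ex}+\sum_{j\ne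 i}r_jq_j$. *)

(* Defs.v *)
From HB Require Import structures.
From mathcomp Require Import all_boot all_order all_algebra.
From mathcomp Require Import reals.

Set Implicit Arguments.
Unset Strict Implicit.
Unset Printing Implicit Defensive.

Import Order.TTheory GRing.Theory Num.Theory.
Local Open Scope ring_scope.

(* A choice of one firm is a pair (r, q): technology, quantity. *)
Definition admissible (R : realType) (x : R * R) : Prop :=
  0 <= x.1 <= 1 /\ 0 <= x.2.

(* The derivative u' of the consumers' utility, i.e. (A - x)^+. *)
Definition inverse_demand (R : realType) (A x : R) : R := Num.max (A - x) 0.

(* [alpha2] is the second moment of the random variable alpha under the belief
   of the firm; [Qo] and [Ko] are the aggregates Q_{-i} and K_{-i}. *)
Definition expected_profit (R : realType) (A b c d alpha2 Qo Ko : R)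
    (x : R * R) : R :=
  let: (r, q) := x in
  inverse_demand A (q + Qo) * q
  - b * alpha2 * (r * q + Ko) * (r * q)
  - (c + d - d * r) * q.

Definition others_quantity (R : realType) (n : nat)
    (p : {ffun 'I_n -> R * R}) (i : 'I_n) : R :=
  \sum_(j < n | j != i) (p j).2.

Definition others_carbon (R : realType) (n : nat) (Kex : R)
    (p : {ffun 'I_n -> R * R}) (i : 'I_n) : R :=
  Kex + \sum_(j < n | j != i) (p j).1 * (p j).2.

Definition nash_equilibrium (R : realType) (n : nat) (A b c d Kex : R)
    (alpha2 : 'I_n -> R) (p : {ffun 'I_n -> R * R}) : Prop :=
  forall i : 'I_n,
    let profit := expected_profit A b c d (alpha2 i)
                    (others_quantity p i) (others_carbon Kex p i) in
    admissible (p i) /\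
    forall x : R * R, admissible x -> profit x <= profit (p i).

(* When q = 0 the profit does not depend on r; the technology of an inactive
   firm is fixed to 0. *)
Definition inactive_convention (R : realType) (n : nat)
    (p : {ffun 'I_n -> R * R}) : Prop :=
  forall i : 'I_n, (p i).2 = 0 -> (p i).1 = 0.

(* Main.v *)
Require Import Defs.
From HB Require Import structures.
From mathcomp Require Import all_boot all_order all_algebra.
From mathcomp Require Import boolp classical_sets reals.
From mathcomp Require Import ring lra.

Set Implicit Arguments.
Unset Strict Implicit.
Unset Printing Implicit Defensive.

Import Order.TTheory GRing.Theory Num.Theory.
Local Open Scope ring_scope.

(** The game is rewritten in the coordinates (q, k) with k = r q, in which the
    choices of a firm form the cone 0 <= k <= q and, as long as the price is not
    cut off at 0, its profit is a concave quadratic function.  The cut-off is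
    harmless: at price 0 an active firm loses at least c q, and staying
    inactive yields 0, so cutting off changes neither the maximizers nor the
    maximal value ([expected_profit_bounds], [best_choice_reply]).

    The first order conditions of firm i involve the other firms only through
    the totals Q and K ([reply], [replyP]).  An equilibrium is therefore a pair
    (Q, K) that is reproduced by the sum of the individual replies to it, and
    everything rests on two monotonicity properties of a reply:
    - output q and emission k are nonincreasing in Q and in K, and when Q or K
      decreases by e they rise by at most e ([reply_comparison]);
    - the clean gap q - k is nonincreasing in Q but nondecreasing in K
      ([reply_clean_gap]).

    Uniqueness.  Let (Q, K) and (Q', K') be equilibrium totals with K <= K'.
    If Q < Q', every firm would produce at most as much in the second
    equilibrium, which is absurd; so Q' <= Q.  Then every clean gap is at least
    as large in the second equilibrium, and the sum over the firms gives
    Q - K <= Q' - K'.  Both inequalities together force Q = Q' and K = K'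
    ([aggregate_comparison], [reply_equilibrium_unique]).

    Existence.  For a fixed K, the total output replied to Q is a nonincreasing
    Lipschitz function of Q, hence has a fixed point Q(K).  The argument used
    for uniqueness shows that Q(K) is nonincreasing and that the total emission
    replied to (Q(K), K) is again nonincreasing and Lipschitz in K, so that it
    has a fixed point too ([nonincreasing_fixpoint], [output_equilibrium],
    [reply_equilibrium]). *)

(** * The reply of one firm to the totals *)

(** The Karush-Kuhn-Tucker conditions on the cone 0 <= k <= q.  With
    u = A - c - d - Q and total emission K, the partial derivatives of the
    profit in q and k are u - q and s.  The derivatives along the two edges
    (1, 0) and (1, 1) of the cone, u - q and u - q + s, must be nonpositive, and
    each must vanish when its edge carries positive weight in
    (q, k) = (q - k) (1, 0) + k (1, 1). *)
Definition reply (R : realType) (d beta u K q k : R) : Prop :=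
  let s := d - beta * (K + k) in
  [/\ 0 <= k <= q, u <= q, u + s <= q, (q - k) * (q - u) = 0
    & k * (q - u - s) = 0].

(** The reply is the projection of the unconstrained optimum (u, v / beta), with
    v = d - beta K, on the cone, for the norm q^2 + beta k^2.  The cases are the
    faces of the cone; the last two cover beta = 0, where the optimum lies
    infinitely far in the direction of k. *)
Lemma reply_exists (R : realType) (d beta u K : R) :
  0 < d -> 0 <= beta -> exists z : R * R, reply d beta u K z.1 z.2.
Proof.
move=> d0 b0; have b1 : 0 < 1 + beta by lra.
have [v0|v0] := leP (d - beta * K) 0.
  have [u0|u0] := leP u 0.
    by exists (0, 0); split => /=; rewrite ?lexx ?addr0 //; lra.
  by exists (u, 0); split => /=; lra.
have [vu|vu] := leP (d - beta * K) (beta * u).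
  have bp : 0 < beta.
    by rewrite lt_def b0 andbT; apply/eqP => bE; move: vu v0; rewrite bE; lra.
  have sE : d - beta * (K + (d - beta * K) / beta) = 0 by field; rewrite gt_eqF.
  have k0 : 0 <= (d - beta * K) / beta by apply: divr_ge0 => //; exact: ltW.
  have ku : (d - beta * K) / beta <= u by rewrite ler_pdivrMr // [u * _]mulrC.
  by exists (u, (d - beta * K) / beta); split; rewrite /= ?sE ?k0 ?ku //; lra.
have [w0|w0] := leP (u + (d - beta * K)) 0.
  by exists (0, 0); split => /=; rewrite ?lexx //; lra.
set t := (u + (d - beta * K)) / (1 + beta).
have tE : t * (1 + beta) = u + (d - beta * K) by rewrite mulfVK ?gt_eqF.
have t0 : 0 < t by rewrite divr_gt0.
have ut : u <= t by rewrite ler_pdivlMr //; lra.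
have sE : t - u - (d - beta * (K + t)) = 0 by lra.
by exists (t, t); split; rewrite /= ?lexx ?(ltW t0) ?sE //; lra.
Qed.

(** If the marginal value is already nonpositive at x, then beta cannot vanish,
    because d > 0; hence the strict decrease. *)
Lemma marginal_strict (R : realType) (d beta x y : R) :
  0 < d -> 0 <= beta -> x < y -> d - beta * x <= 0 -> d - beta * y < 0.
Proof.
move=> d0 b0 xy hx; have bp : 0 < beta.
  by rewrite lt_def b0 andbT; apply/eqP => bE; move: hx; rewrite bE; lra.
have := ltr_pM2l bp x y; rewrite xy => h; lra.
Qed.

(** Larger totals make the firm produce and emit less.  If the emission k' were
    too large, the total K' + k' would exceed K + k, so that the marginal value
    s' of emission would be at most s; each case of complementarity then
    contradicts this.  The bound on output follows, since output exceeds u only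
    on the edge q = k.  For e = f = 0 this is monotonicity, and applied in both
    directions it is uniqueness of the reply. *)
Lemma reply_comparison (R : realType) (d beta u K q k u' K' q' k' e f : R) :
  0 < d -> 0 <= beta -> 0 <= e -> 0 <= f ->
  reply d beta u K q k -> reply d beta u' K' q' k' ->
  u' <= u + e -> K <= K' + f ->
  q' <= q + e + f /\ k' <= k + e + f.
Proof.
move=> d0 b0 e0 f0 [/andP[k0 kq] uq usq c1 c2]
  [/andP[k0' kq'] uq' usq' c1' c2'] ue Kf.
have hk : k' <= k + e + f.
  rewrite leNgt; apply/negP => lt_k.
  have lt_tot : K + k < K' + k' by lra.
  have le_s := ler_wpM2l b0 (ltW lt_tot).
  have strict := marginal_strict d0 b0 lt_tot.
  move/eqP: c2'; rewrite mulf_eq0 => /orP[/eqP ?|/eqP qE']; first lra.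
  move/eqP: c1; rewrite mulf_eq0 => /orP[/eqP ?|/eqP qE]; first lra.
  have s0 : d - beta * (K + k) <= 0 by lra.
  have := strict s0; lra.
split => //.
move/eqP: c1'; rewrite mulf_eq0 => /orP[/eqP ?|/eqP ?]; lra.
Qed.

(** For beta > 0, q - k is explicitly the positive part of u^+ - (d / beta - K)^+, which
    does not decrease in u or in K.  The proof by contradiction again compares the
    marginal values of emission. *)
Lemma reply_clean_gap (R : realType) (d beta u K q k u' K' q' k' : R) :
  0 < d -> 0 <= beta ->
  reply d beta u K q k -> reply d beta u' K' q' k' ->
  u <= u' -> K <= K' -> q - k <= q' - k'.
Proof.
move=> d0 b0 [/andP[k0 kq] uq usq c1 c2]
  [/andP[k0' kq'] uq' usq' c1' c2'] uu KK.
rewrite leNgt; apply/negP => lt_gap.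
move/eqP: c1; rewrite mulf_eq0 => /orP[/eqP ?|/eqP qE]; first lra.
have lt_tot : K + k < K' + k' by lra.
have s0 : d - beta * (K + k) <= 0 by lra.
have s0' := marginal_strict d0 b0 lt_tot s0.
move/eqP: c2'; rewrite mulf_eq0 => /orP[/eqP ?|/eqP ?]; lra.
Qed.

(** * Fixed points of the aggregate replies *)

(** The fixed point is the supremum of the x with x <= f x; the Lipschitz bound
    rules out that f jumps across the diagonal there. *)
Lemma nonincreasing_fixpoint (R : realType) (L : R) (f : R -> R) :
  0 <= L ->
  (forall x y, x <= y -> f y <= f x <= f y + L * (y - x)) ->
  exists x, x = f x.
Proof.
move=> L0 hf; pose E := [set x | x <= f x]%classic.
have L1 : 0 < 1 + L by lra.
have supE : has_sup E.
  split.
    exists (Num.min 0 (f 0)); rewrite /E /=.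
    have [h|h] := leP 0 (f 0) => //.
    by have /andP[] := hf _ _ (ltW h).
  exists (Num.max 0 (f 0)) => x xE; rewrite leNgt; apply/negP.
  rewrite gt_max => /andP[x0 fx]; have /andP[h _] := hf _ _ (ltW x0).
  by move: xE; rewrite /E /=; lra.
exists (sup E); apply/eqP; rewrite eq_le.
apply/andP; split; rewrite leNgt; apply/negP => h.
  (* The constant 1 + L is the largest rate at which f x - x can change. *)
  pose e := (sup E - f (sup E)) / (1 + L).
  have e0 : 0 < e by rewrite divr_gt0 // subr_gt0.
  have eE : e * (1 + L) = sup E - f (sup E) by rewrite mulfVK ?gt_eqF.
  have [x xE xs] := sup_adherent e0 supE.
  have /andP[_ hx] := hf _ _ (sup_upper_bound supE xE).
  have := ler_wpM2l L0 (ltW xs).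
  by move: xE; rewrite /E /=; lra.
pose e := (f (sup E) - sup E) / (1 + L).
have e0 : 0 < e by rewrite divr_gt0 // subr_gt0.
have eE : e * (1 + L) = f (sup E) - sup E by rewrite mulfVK ?gt_eqF.
have se : sup E <= sup E + e by lra.
have /andP[_ hx] := hf _ _ se.
have xE : E (sup E + e) by rewrite /E /=; lra.
have := sup_upper_bound supE xE; lra.
Qed.

(** Total output cannot rise: otherwise each firm would reply to two larger totals
    by producing no more than before.  So u does not fall, nor does K, and hence
    no clean gap shrinks. *)
Lemma aggregate_comparison (R : realType) (n : nat) (d a K K' : R)
    (beta q k q' k' : 'I_n -> R) :
  0 < d -> (forall i, 0 <= beta i) ->
  (forall i, reply d (beta i) (a - \sum_j q j) K (q i) (k i)) ->
  (forall i, reply d (beta i) (a - \sum_j q' j) K' (q' i) (k' i)) ->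
  K <= K' ->
  \sum_i q' i <= \sum_i q i /\
  \sum_i q i - \sum_i k i <= \sum_i q' i - \sum_i k' i.
Proof.
move=> d0 b0 h h' KK.
have QQ : \sum_i q' i <= \sum_i q i.
  rewrite leNgt; apply/negP => lt_Q.
  have : \sum_i q' i <= \sum_i q i.
    apply: ler_sum => i _.
    have uu : a - \sum_j q' j <= a - \sum_j q j + 0 by lra.
    have KK0 : K <= K' + 0 by lra.
    by have [] := reply_comparison d0 (b0 i) (lexx 0) (lexx 0) (h i) (h' i)
      uu KK0; rewrite !addr0.
  lra.
split=> //; rewrite -!sumrB; apply: ler_sum => i _.
by apply: (reply_clean_gap d0 (b0 i) (h i) (h' i)) => //; lra.
Qed.

(** For a frozen K, the total output replied to Q decreases in Q at rate at most
    n, because each of the n firms contributes at most rate 1. *)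
Lemma output_equilibrium (R : realType) (n : nat) (d a K : R) (beta : 'I_n -> R) :
  0 < d -> (forall i, 0 <= beta i) ->
  exists z : 'I_n -> R * R,
    forall i, reply d (beta i) (a - \sum_j (z j).1) K (z i).1 (z i).2.
Proof.
move=> d0 b0.
have [z zP] := choice (fun x : 'I_n * R => reply_exists x.2 K d0 (b0 x.1)).
have [||Q QE] := @nonincreasing_fixpoint R n%:R (fun Q => \sum_j (z (j, a - Q)).1).
- exact: ler0n.
- move=> x y xy; have d_ge0 : 0 <= y - x by lra.
  have uu : a - y <= a - x + 0 by lra.
  have uu' : a - x <= a - y + (y - x) by lra.
  have KK : K <= K + 0 by lra.
  apply/andP; split.
    apply: ler_sum => i _.
    by have [+ _] := reply_comparison d0 (b0 i) (lexx 0) (lexx 0)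
      (zP (i, a - x)) (zP (i, a - y)) uu KK; rewrite !addr0.
  rewrite mulr_natl -[n in _ *+ n]card_ord -sumr_const -big_split /=.
  apply: ler_sum => i _.
  by have [+ _] := reply_comparison d0 (b0 i) d_ge0 (lexx 0)
    (zP (i, a - y)) (zP (i, a - x)) uu' KK; rewrite !addr0.
by exists (fun i => z (i, a - Q)) => i; rewrite -QE; apply: (zP (i, a - Q)).
Qed.

(** A larger K lowers total output and raises the total clean gap, hence lowers
    total emission, by at least as much as output: the emission replied to K is
    nonincreasing.  It falls at rate at most n, because the fall of Q can only
    raise the individual emissions. *)
Lemma reply_equilibrium (R : realType) (n : nat) (d a Kex : R) (beta : 'I_n -> R) :
  0 < d -> (forall i, 0 <= beta i) ->
  exists z : 'I_n -> R * R,
    forall i, reply d (beta i) (a - \sum_j (z j).1) (Kex + \sum_j (z j).2)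
                (z i).1 (z i).2.
Proof.
move=> d0 b0.
have [z zP] := choice (fun K => output_equilibrium a K d0 b0).
have [||K KE] := @nonincreasing_fixpoint R n%:R (fun K => Kex + \sum_j (z K j).2).
- exact: ler0n.
- move=> x y xy.
  have [QQ gap] := aggregate_comparison d0 b0 (zP x) (zP y) xy.
  apply/andP; split; first lra.
  rewrite -addrA lerD2l mulr_natl -[n in _ *+ n]card_ord -sumr_const -big_split /=.
  apply: ler_sum => i _.
  have uu : a - \sum_j (z x j).1 <= a - \sum_j (z y j).1 + 0 by lra.
  have yx : 0 <= y - x by lra.
  have KK : y <= x + (y - x) by lra.
  by have [_] := reply_comparison d0 (b0 i) (lexx 0) yx
    (zP y i) (zP x i) uu KK; rewrite !addr0.
by exists (z K); rewrite -KE.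
Qed.

Lemma reply_equilibrium_unique (R : realType) (n : nat) (d a Kex : R)
    (beta q k q' k' : 'I_n -> R) :
  0 < d -> (forall i, 0 <= beta i) ->
  (forall i, reply d (beta i) (a - \sum_j q j) (Kex + \sum_j k j) (q i) (k i)) ->
  (forall i, reply d (beta i) (a - \sum_j q' j) (Kex + \sum_j k' j)
     (q' i) (k' i)) ->
  forall i, q i = q' i /\ k i = k' i.
Proof.
move=> d0 b0 h h' i.
have [QQ KK] : \sum_j q j = \sum_j q' j /\ \sum_j k j = \sum_j k' j.
  have [KK|KK] := leP (Kex + \sum_j k j) (Kex + \sum_j k' j).
    have [] := aggregate_comparison d0 b0 h h' KK; lra.
  have [] := aggregate_comparison d0 b0 h' h (ltW KK); lra.
have := h' i; rewrite -QQ -KK => hi'.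
set u := a - _ in hi'; set K := Kex + _ in hi'.
have uu : u <= u + 0 by rewrite addr0.
have KK0 : K <= K + 0 by rewrite addr0.
have [] := reply_comparison d0 (b0 i) (lexx 0) (lexx 0) (h i) hi' uu KK0.
have [] := reply_comparison d0 (b0 i) (lexx 0) (lexx 0) hi' (h i) uu KK0.
by rewrite !addr0; lra.
Qed.

(** * Profit maximization and the reply conditions *)

(** The expected profit in the coordinates (q, k), with a = A - c - d and with
    the price A - q - Qo in place of its positive part. *)
Definition quadratic_profit (R : realType) (a d beta Qo Ko q k : R) : R :=
  (a - q - Qo) * q + (d - beta * (k + Ko)) * k.

Lemma quadratic_profit_taylor (R : realType) (a d beta Qo Ko q k q' k' : R) :
  quadratic_profit a d beta Qo Ko q' k' = quadratic_profit a d beta Qo Ko q k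
  + ((a - (q + Qo) - q) * (q' - q) + (d - beta * (k + Ko + k)) * (k' - k))
  - ((q' - q) ^+ 2 + beta * (k' - k) ^+ 2).
Proof. rewrite /quadratic_profit; ring. Qed.

(** A linear term dominated by a quadratic one near 0 cannot be positive. *)
Lemma first_order_le0 (R : realType) (g h : R) :
  0 <= h -> (forall t, 0 < t <= 1 -> t * g <= t ^+ 2 * h) -> g <= 0.
Proof.
move=> h0 H; rewrite leNgt; apply/negP => g0.
have gh : 0 < g + h by lra.
(* At this t the inequality divided by t reads g <= g h / (g + h), that is t g <= 0. *)
have := H (g / (g + h)) _.
rewrite divr_gt0 // ler_pdivrMr // mul1r lerDl h0 => /(_ isT).
set t := g / (g + h).
have t0 : 0 < t by rewrite divr_gt0.
have tE : t * (g + h) = g by rewrite mulfVK ?gt_eqF.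
rewrite expr2 -mulrA ler_pM2l // => ?.
have : 0 < t * g by rewrite mulr_gt0.
lra.
Qed.

(** The second order term of the exact expansion is nonpositive, so the first
    order conditions suffice.  They are necessary because the segment from the
    optimum to any point of the cone stays in the cone. *)
Lemma replyP (R : realType) (a d beta Qo Ko q k : R) :
  0 <= beta ->
  (reply d beta (a - (q + Qo)) (k + Ko) q k <->
   0 <= k <= q /\ forall q' k', 0 <= k' <= q' ->
     quadratic_profit a d beta Qo Ko q' k' <=
     quadratic_profit a d beta Qo Ko q k).
Proof.
move=> b0; split=> [[kq uq usq c1 c2]|[/andP[k0 kq] opt]].
  split=> // q' k' /andP[k0' kq'].
  rewrite (quadratic_profit_taylor _ _ _ _ _ q k).
  have := mulr_ge0 b0 (sqr_ge0 (k' - k)).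
  have := sqr_ge0 (q' - q).
  move: uq usq c1 c2; set u := a - _; set s := d - _ => uq usq c1 c2.
  have : 0 <= (q' - k') * (q - u) by apply: mulr_ge0; lra.
  have : 0 <= k' * (q - u - s) by apply: mulr_ge0; lra.
  lra.
set u := a - (q + Qo); set s := d - beta * (k + Ko + k).
have VI q' k' : 0 <= k' <= q' -> (u - q) * (q' - q) + s * (k' - k) <= 0.
  move=> /andP[k0' kq'].
  apply: (@first_order_le0 _ _ ((q' - q) ^+ 2 + beta * (k' - k) ^+ 2)).
    by rewrite addr_ge0 ?sqr_ge0 // mulr_ge0 ?sqr_ge0.
  move=> t /andP[t0 t1].
  have tk : 0 <= t * k' by rewrite mulr_ge0 // ltW.
  have t1k : 0 <= (1 - t) * k by rewrite mulr_ge0 // subr_ge0.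
  have tq : t * k' <= t * q' by rewrite ler_wpM2l // ltW.
  have t1q : (1 - t) * k <= (1 - t) * q by rewrite ler_wpM2l // subr_ge0.
  have cone : 0 <= k + t * (k' - k) <= q + t * (q' - q) by apply/andP; split; lra.
  have := opt _ _ cone.
  rewrite (quadratic_profit_taylor _ _ _ _ _ q k) -/u -/s; lra.
(* Moving towards the apex and along the two edges; the first inequality
   bounds the sum of the two nonnegative complementarity products by 0. *)
have v0 : (u - q) * (0 - q) + s * (0 - k) <= 0 by apply: VI; rewrite lexx.
have vq : (u - q) * (q + 1 - q) + s * (k - k) <= 0.
  by apply: VI; apply/andP; split; lra.
have vd : (u - q) * (q + 1 - q) + s * (k + 1 - k) <= 0.
  by apply: VI; apply/andP; split; lra.
have p1 : 0 <= (q - k) * (q - u) by apply: mulr_ge0; lra.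
have p2 : 0 <= k * (q - u - s) by apply: mulr_ge0; lra.
split; rewrite -/s; [by rewrite k0|lra..].
Qed.

(** Where the price is cut off, the revenue is 0 and the costs are at least c q,
    so that the true profit lies between the quadratic one and 0; it reaches 0
    only for q = 0, where both coincide. *)
Lemma expected_profit_bounds (R : realType) (A b c d alpha2 Qo Ko r q : R) :
  0 <= b * alpha2 -> 0 < c -> 0 < d -> 0 <= Ko -> admissible (r, q) ->
  let free := quadratic_profit (A - c - d) d (b * alpha2) Qo Ko q (r * q) in
  [/\ free <= expected_profit A b c d alpha2 Qo Ko (r, q),
      expected_profit A b c d alpha2 Qo Ko (r, q) <= Num.max free 0 &
      0 <= expected_profit A b c d alpha2 Qo Ko (r, q) ->
        expected_profit A b c d alpha2 Qo Ko (r, q) = free].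
Proof.
move=> b0 c0 d0 Ko0 [/andP[/= r0 r1] q0] /=.
rewrite /inverse_demand /quadratic_profit.
have rq0 : 0 <= r * q by rewrite mulr_ge0.
have rqq : r * q <= q by rewrite -[leRHS]mul1r ler_wpM2r.
have damage : 0 <= b * alpha2 * (r * q + Ko) * (r * q).
  by do 2![apply: mulr_ge0 => //]; apply: addr_ge0.
have drq : d * (r * q) <= d * q by rewrite ler_wpM2l // ltW.
have cq : 0 <= c * q by rewrite mulr_ge0 // ltW.
have [h|h] := leP (A - (q + Qo)) 0.
  have hq : (A - (q + Qo)) * q <= 0 by rewrite mulr_le0_ge0.
  split; first lra.
    by rewrite le_max; apply/orP; right; lra.
  move=> ge0.
  have /eqP : c * q = 0 by lra.
  by rewrite mulf_eq0 gt_eqF //= => /eqP ->; ring.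
have E : (A - (q + Qo)) * q - b * alpha2 * (r * q + Ko) * (r * q)
    - (c + d - d * r) * q = (A - c - d - q - Qo) * q
    + (d - b * alpha2 * (r * q + Ko)) * (r * q) by ring.
by rewrite E; split => //; rewrite le_max lexx.
Qed.

(** Since inactivity yields 0, the cut-off of the price changes neither the
    maximizers nor the maximal value.  Every point of the cone is a choice (r, q)
    with r = k / q; for q = 0 this quotient is 0, which is admissible. *)
Lemma best_choice_reply (R : realType) (A b c d alpha2 Qo Ko r q : R) :
  0 <= b * alpha2 -> 0 < c -> 0 < d -> 0 <= Ko -> (q = 0 -> r = 0) ->
  ((admissible (r, q) /\ forall x, admissible x ->
      expected_profit A b c d alpha2 Qo Ko x <=
      expected_profit A b c d alpha2 Qo Ko (r, q)) <->
   admissible (r, q) /\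
   reply d (b * alpha2) (A - c - d - (q + Qo)) (r * q + Ko) q (r * q)).
Proof.
move=> b0 c0 d0 Ko0 conv.
have zero_adm : admissible (0 : R, 0 : R) by rewrite /admissible /= lexx ler01.
have zero_profit : expected_profit A b c d alpha2 Qo Ko (0, 0) = 0.
  by rewrite /expected_profit; ring.
have cone x y : admissible (x, y) -> 0 <= x * y <= y.
  move=> [/andP[/= x0 x1] y0]; rewrite mulr_ge0 //=.
  by rewrite -[leRHS]mul1r ler_wpM2r.
split=> -[adm]; have [lo up eqf] := expected_profit_bounds A Qo b0 c0 d0 Ko0 adm.
  move=> opt; split=> //; apply/replyP => //; split; first exact: cone.
  move=> q' k' /andP[k0' kq'].
  rewrite -eqf; last by rewrite -zero_profit; apply: opt.
  have q0' : 0 <= q' := le_trans k0' kq'.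
  have kE : k' / q' * q' = k'.
    have [q'E|q'0] := eqVneq q' 0; last by rewrite mulfVK.
    by rewrite q'E mulr0; apply/eqP; rewrite eq_le k0' -q'E kq'.
  have adm' : admissible (k' / q', q').
    split=> //=; rewrite divr_ge0 //=.
    have [->|q'0] := eqVneq q' 0; first by rewrite invr0 mulr0.
    by rewrite ler_pdivrMr ?mul1r // lt_def q'0.
  have [lo' _ _] := expected_profit_bounds A Qo b0 c0 d0 Ko0 adm'.
  by rewrite -{1}kE; apply: le_trans lo' (opt _ adm').
move=> /(proj1 (replyP _ _ _ _ _ _ b0)) [_ opt]; split=> // -[r' q'] adm'.
have [_ up' _] := expected_profit_bounds A Qo b0 c0 d0 Ko0 adm'.
apply: le_trans up' _; apply: le_trans lo; rewrite ge_max opt ?cone //=.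
have := opt 0 0; rewrite lexx => /(_ isT); apply: le_trans.
by rewrite /quadratic_profit !mulr0 addr0.
Qed.

Lemma nash_reply (R : realType) (n : nat) (A b c d Kex : R)
    (alpha2 : 'I_n -> R) (p : {ffun 'I_n -> R * R}) :
  0 < b -> 0 < c -> 0 < d -> 0 <= Kex -> (forall i, 0 <= alpha2 i) ->
  inactive_convention p ->
  (nash_equilibrium A b c d Kex alpha2 p <->
   forall i, admissible (p i) /\
     reply d (b * alpha2 i) (A - c - d - \sum_j (p j).2)
       (Kex + \sum_j (p j).1 * (p j).2) (p i).2 ((p i).1 * (p i).2)).
Proof.
move=> b0 c0 d0 K0 a0 conv.
have ba0 i : 0 <= b * alpha2 i by rewrite mulr_ge0 // ltW.
have QE i : \sum_j (p j).2 = (p i).2 + others_quantity p i by rewrite (bigD1 i).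
have KE i : Kex + \sum_j (p j).1 * (p j).2 =
    (p i).1 * (p i).2 + others_carbon Kex p i.
  by rewrite (bigD1 i) //= addrCA.
have Ko0 : (forall j, admissible (p j)) -> forall i, 0 <= others_carbon Kex p i.
  move=> adm i; rewrite /others_carbon; apply: addr_ge0 => //; apply: sumr_ge0 => j _.
  by have [/andP[? _] ?] := adm j; rewrite mulr_ge0.
have individual i : 0 <= others_carbon Kex p i -> _ :=
  fun Ki => best_choice_reply A (others_quantity p i) (ba0 i) c0 d0 Ki (conv i).
split=> h i.
  rewrite (QE i) (KE i).
  have Ki : 0 <= others_carbon Kex p i by apply: Ko0 => j; have [] := h j.
  by move: (h i) (individual i Ki) => /=; case: (p i) => r q /= hi [+ _]; apply.
have Ki : 0 <= others_carbon Kex p i by apply: Ko0 => j; have [] := h j.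
move: (h i) (individual i Ki) => /=; rewrite (QE i) (KE i).
by case: (p i) => r q /= hi [_ +]; apply.
Qed.

(** * Existence and uniqueness of the equilibrium *)

Theorem theorem2p3 (R : realType) (n : nat) (A b c d Kex : R)
    (alpha2 : 'I_n -> R)
    (n_ge1 : (1 <= n)%N)
    (A_gt0 : 0 < A) (b_gt0 : 0 < b) (c_gt0 : 0 < c) (d_gt0 : 0 < d)
    (Kex_ge0 : 0 <= Kex)
    (alpha2_ge0 : forall i : 'I_n, 0 <= alpha2 i) :
  exists! p : {ffun 'I_n -> R * R},
    nash_equilibrium A b c d Kex alpha2 p /\ inactive_convention p.
Proof.
have ba0 i : 0 <= b * alpha2 i by rewrite mulr_ge0 // ltW.
have [z zP] := reply_equilibrium (A - c - d) Kex d_gt0 ba0.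
have z_cone i : 0 <= (z i).2 <= (z i).1 by have [] := zP i.
pose p := [ffun i => ((z i).2 / (z i).1, (z i).1)].
have kE i : (p i).1 * (p i).2 = (z i).2.
  rewrite ffunE /=; have [zE|zi0] := eqVneq (z i).1 0; last by rewrite mulfVK.
  by have := z_cone i; rewrite zE mulr0; lra.
have qE i : (p i).2 = (z i).1 by rewrite ffunE.
have conv : inactive_convention p.
  by move=> i; rewrite ffunE /= => ->; rewrite invr0 mulr0.
have nash : nash_equilibrium A b c d Kex alpha2 p.
  apply/nash_reply => // i; split.
    have /andP[k0 kq] := z_cone i; have q0 := le_trans k0 kq.
    rewrite ffunE; split=> //=; rewrite divr_ge0 //=.
    have [->|zi0] := eqVneq (z i).1 0; first by rewrite invr0 mulr0.
    by rewrite ler_pdivrMr ?mul1r // lt_def zi0.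
  rewrite kE qE (eq_bigr _ (fun j _ => qE j)) (eq_bigr _ (fun j _ => kE j)).
  exact: zP.
exists p; split=> // p' [nash' conv'].
move/nash_reply: nash => /(_ b_gt0 c_gt0 d_gt0 Kex_ge0 alpha2_ge0 conv) nash.
move/nash_reply: nash' => /(_ b_gt0 c_gt0 d_gt0 Kex_ge0 alpha2_ge0 conv') nash'.
apply/ffunP => i.
have [qpE] := reply_equilibrium_unique d_gt0 ba0 (fun i => proj2 (nash i))
  (fun i => proj2 (nash' i)) i.
move: (conv i) (conv' i) qpE; case: (p i) (p' i) => [r q] [r' q'] /=.
have [->|q0] := eqVneq q 0 => cr cr' qpE; first by move=> _; rewrite cr // cr' -?qpE.
by rewrite -qpE => /(mulIf q0) ->.
Qed.
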